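(* Let $\mathbf p_i\neq\mathbf p_f$ be points of $\mathbb E^3$, let $(\mathbf u_i,\mathbf v_i,\mathbf w_i)$ be an orthonormal triple, and let $\mathbf u_f$ be a unit vector with $\mathbf u_i\times\mathbf u_f\neq\mathbf 0$. Put $\Delta\mathbf p=\mathbf p_f-\mathbf p_i$, $\Delta\mathbf u=\Delta\mathbf p/|\Delta\mathbf p|$, and assume $\mathbf u_i\cdot\Delta\mathbf u=\Delta\mathbf u\cdot\mathbf u_f$. Let $\gamma=\arccos(\mathbf u_i\cdot\mathbf u_f)\in(0,\pi)$ and $\mathbf b=(\mathbf u_i+\mathbf u_f)/|\mathbf u_i+\mathbf u_f|$. If $$\mathbf b\cdot\Delta\mathbf u>\mathbf b\cdot\mathbf S_\gamma\left(\tfrac{2\pi}3\right),$$ then there exists at least one RRMF5-I curve $\mathbf r$, with associated rational rotation-minimizing frame $(\mathbf f_1,\mathbf f_2,\mathbf f_3)$, solving the interpolation problem $$\mathbf r(0)=\mathbf p_i,\quad \mathbf r(1)=\mathbf p_f,\qquad (\mathbf f_1(0),\mathbf f_2(0),\mathbf f_3(0))=(\mathbf u_i,\mathbf v_i,\mathbf w_i),\qquad \mathbf r'(0)=\mu^2\mathbf u_i,\quad \mathbf r'(1)=\mu^2\mathbf u_f$$ for some real $\mu>0$.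
   Context: Let $\mathbb H$ be the quaternions, with pure vector quaternions identified with $\mathbb R^3$; $\mathcal A^*$ denotes conjugation and $\mathrm{vect}$ the vector part. Fix a unit pure vector $\mathbf i$; $B_i^2(t)=\binom 2i t^i(1-t)^{2-i}$. An RRMF5-I curve is a polynomial curve $\mathbf r:[0,1]\to\mathbb E^3$ with hodograph $\mathbf r'(t)=\mathcal A(t)\,\mathbf i\,\mathcal A^*(t)$, where $\mathcal A(t)=\mathcal A_0B_0^2(t)+\mathcal A_1B_1^2(t)+\mathcal A_2B_2^2(t)$, $\mathcal A_j\in\mathbb H$, and $\mathcal A_1\,\mathbf i\,\mathcal A_1^*=\mathrm{vect}(\mathcal A_2\,\mathbf i\,\mathcal A_0^* )$. It is known that this algebraic condition ensures that $\mathbf r$ has a rational rotation-minimizing frame. An adapted frame along $\mathbf r$ is a triple $(\mathbf f_1,\mathbf f_2,\mathbf f_3)$ of mutually orthogonal unit vectors depending on $t$, with $\mathbf f_1=\mathbf r'/|\mathbf r'|$; it is rotation-minimizing if it does not rotate in the normal plane about $\mathbf f_1$ (i.e. $\mathbf f_2'$ and $\mathbf f_3'$ are parallel to $\mathbf f_1$), and rational if its components are rational functions of $t$. A rotation-minimizing frame is determined up to a constant rotation in the normal plane. Definition of $\mathbf S_\gamma$: let $\mathbf n=-(\mathbf u_i\times\mathbf u_f)/|\mathbf u_i\times\mathbf u_f|$ and, for $\varphi_2\in\mathbb R$, $$\mathbf q_1=\mathbf u_i+\mathbf u_f=\sqrt{2(1+\cos\gamma)}\,\mathbf b,\qquad \mathbf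 q_2(\varphi_2)=\cos\varphi_2\,\mathbf b+\sin\varphi_2\,\sin\tfrac\gamma2\,\mathbf n,$$ $$\mathbf s_2=\frac{\mathbf q_2}{|\mathbf q_2|},\qquad \mathbf s_{02}=\frac{\mathbf q_1+2\mathbf q_2}{2(1+\cos\varphi_2\cos\frac\gamma2)},\qquad \mathbf q_3(\varphi_2)=\sqrt{|\mathbf q_2|}\,\sqrt{2\left(1+\cos\varphi_2\cos\tfrac\gamma2\right)}\;\frac{\mathbf s_{02}+\mathbf s_2}{|\mathbf s_{02}+\mathbf s_2|}.$$ Then $\mathbf I_\gamma(\varphi_2)=\mathbf q_1+\mathbf q_2(\varphi_2)+\mathbf q_3(\varphi_2)$ and $\mathbf S_\gamma(\varphi_2)=\mathbf I_\gamma(\varphi_2)/|\mathbf I_\gamma(\varphi_2)|$ whenever $\mathbf I_\gamma(\varphi_2)\neq\mathbf 0$ (which holds for $\varphi_2=2\pi/3$). *)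

(* Defs.v *)
From HB Require Import structures.
From mathcomp Require Import all_boot all_order all_algebra.
From mathcomp Require Import all_classical all_reals all_analysis.
Import Order.TTheory GRing.Theory Num.Theory.
Import numFieldNormedType.Exports.

Set Implicit Arguments.
Unset Strict Implicit.
Unset Printing Implicit Defensive.

Local Open Scope ring_scope.

Section Vectors.
Context {R : realType}.
Implicit Types u v w : 'rV[R]_3.

Definition dotv u v : R := \sum_(k < 3) u 0 k * v 0 k.

(* The library norm [`|u|] on row vectors is the sup norm; [enorm] is the
   Euclidean one. *)
Definition enorm u : R := Num.sqrt (dotv u u).

Definition normalize u : 'rV[R]_3 := (enorm u)^-1 *: u.

Definition crossv u v : 'rV[R]_3 :=
  let a (k : nat) := u 0 (inord k) in
  let b (k : nat) := v 0 (inord k) in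
  \row_(k < 3) [:: a 1%N * b 2%N - a 2%N * b 1%N;
                   a 2%N * b 0%N - a 0%N * b 2%N;
                   a 0%N * b 1%N - a 1%N * b 0%N]`_k.

Definition orthonormal3 u v w : Prop :=
  [/\ enorm u = 1, enorm v = 1 & enorm w = 1] /\
  [/\ dotv u v = 0, dotv u w = 0 & dotv v w = 0].

End Vectors.

(* A quaternion is the pair (scalar part, vector part); addition and real
   scaling are those of the product module. *)
Definition quaternion (R : realType) : lmodType R := (R^o * 'rV[R]_3)%type.

Section Quaternions.
Context {R : realType}.
Implicit Types A B : quaternion R.

Definition qpure (v : 'rV[R]_3) : quaternion R := (0, v).

Definition vect A : 'rV[R]_3 := A.2.

Definition qconj A : quaternion R := (A.1, - A.2).

Definition qmul A B : quaternion R :=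
  (A.1 * B.1 - dotv A.2 B.2, A.1 *: B.2 + B.1 *: A.2 + crossv A.2 B.2).

End Quaternions.

Section Curves.
Context {R : realType}.
Implicit Types (r f : R -> 'rV[R]_3) (t : R).

Definition bernstein (n k : nat) t : R :=
  'C(n, k)%:R * t ^+ k * (1 - t) ^+ (n - k).

Definition quadratic_quat (A0 A1 A2 : quaternion R) t : quaternion R :=
  bernstein 2 0 t *: A0 + bernstein 2 1 t *: A1 + bernstein 2 2 t *: A2.

(* A polynomial curve on [0,1] is represented by its unique polynomial extension
   to the whole line, so that two-sided derivatives make sense at 0 and 1. *)
Definition polynomial_curve r : Prop :=
  exists P : 'I_3 -> {poly R}, forall t k, r t 0 k = (P k).[t].

Definition RRMF5_I (i : 'rV[R]_3) r : Prop :=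
  polynomial_curve r /\
  exists A0 A1 A2 : quaternion R,
    qmul (qmul A1 (qpure i)) (qconj A1)
      = qpure (vect (qmul (qmul A2 (qpure i)) (qconj A0))) /\
    forall t, 0 <= t <= 1 ->
      let A := quadratic_quat A0 A1 A2 t in
      qpure (derive1 r t) = qmul (qmul A (qpure i)) (qconj A).

(* The components are rational functions without poles on [0,1]. As for curves,
   the function is given on the whole line by the same formula, with value 0 at
   any pole; only its germ along [0,1] matters. *)
Definition rational_on01 f : Prop :=
  forall k : 'I_3, exists N D : {poly R},
    (forall t, 0 <= t <= 1 -> D.[t] != 0) /\
    (forall t, f t 0 k = N.[t] / D.[t]).

(* Since [normalize 0 = 0] is not a unit vector, this forces the curve to be
   regular on [0,1]. *)
Definition adapted_frame r f1 f2 f3 : Prop :=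
  forall t, 0 <= t <= 1 ->
    orthonormal3 (f1 t) (f2 t) (f3 t) /\ f1 t = normalize (derive1 r t).

Definition rotation_minimizing f1 f2 f3 : Prop :=
  forall t, 0 <= t <= 1 ->
    (exists c : R, is_derive t 1 f2 (c *: f1 t)) /\
    (exists c : R, is_derive t 1 f3 (c *: f1 t)).

Definition rational_RMF r f1 f2 f3 : Prop :=
  [/\ adapted_frame r f1 f2 f3,
      rotation_minimizing f1 f2 f3 &
      [/\ rational_on01 f1, rational_on01 f2 & rational_on01 f3]].

End Curves.

Section SGamma.
Context {R : realType}.
Variables ui uf : 'rV[R]_3.

Definition gamma_angle : R := acos (dotv ui uf).

Definition bisector : 'rV[R]_3 := normalize (ui + uf).

Definition nvec : 'rV[R]_3 := - normalize (crossv ui uf).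

Definition q1 : 'rV[R]_3 := ui + uf.

Definition q2 (phi : R) : 'rV[R]_3 :=
  cos phi *: bisector + (sin phi * sin (gamma_angle / 2)) *: nvec.

Definition s2 (phi : R) : 'rV[R]_3 := normalize (q2 phi).

Definition s02 (phi : R) : 'rV[R]_3 :=
  (2 * (1 + cos phi * cos (gamma_angle / 2)))^-1 *: (q1 + 2 *: q2 phi).

Definition q3 (phi : R) : 'rV[R]_3 :=
  (Num.sqrt (enorm (q2 phi)) *
   Num.sqrt (2 * (1 + cos phi * cos (gamma_angle / 2))))
  *: normalize (s02 phi + s2 phi).

Definition I_gamma (phi : R) : 'rV[R]_3 := q1 + q2 phi + q3 phi.

Definition S_gamma (phi : R) : 'rV[R]_3 := normalize (I_gamma phi).

End SGamma.

(* Main.v *)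
Require Import Defs.
From mathcomp Require Import all_boot all_order all_algebra.
From mathcomp Require Import all_classical all_reals all_analysis.
From mathcomp Require Import ring lra.
Import Order.TTheory GRing.Theory Num.Theory.
Import numFieldNormedType.Exports.
Local Open Scope ring_scope.
Set Implicit Arguments.
Unset Strict Implicit.
Unset Printing Implicit Defensive.

(** The symmetry hypothesis puts the chord in the plane spanned by the bisector
b and the normal n, so only one angle has to be matched, and the intermediate
value theorem does it.

Work in the direct orthonormal frame (b, n, m) with m parallel to uf - ui, where
ui = cos(gamma/2) b - sin(gamma/2) m and uf = cos(gamma/2) b + sin(gamma/2) m.
A quaternion G with G i G^* = b multiplies all the control quaternions on the
right, so i can be taken equal to b.  The quaternions X with X b X^* = ui, or
uf, are known up to a right factor exp(b theta); distributing the free angle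
phi symmetrically between the ends gives
  A0 = A - B b + D n + E m   and   A2 = A + B b - D n + E m,
where (A, B) = cos(gamma/4) (cos, sin)(phi/2) and
(D, E) = sin(gamma/4) (cos, sin)(phi/2).
Since m b = n, right multiplication by b identifies the complex plane spanned by
1 and m with the plane spanned by b and n, and z b z^* is then z^2.  Hence
A1 = l + r m with (l + r m)^2 = q2(phi) satisfies the algebraic condition of the
class.  As A0 + A2 = 2 (A + E m), one gets q1 + 2 q2 = 4 (A + E m)^2, and the
vector q3 of the definition of S_gamma is the product 2 (A + E m) (l + r m),
that is vect (A1 b A0^* + A2 b A1^* ).  Integrating the hodograph over [0, 1]
gives (q1 + q2 + q3) / 5 = I_gamma(phi) / 5 ([family_displacement],
[I_gamma_comb]).

As phi runs from 0 to 2 pi / 3, I_gamma(phi) never vanishes and its direction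
moves continuously from b to S_gamma(2 pi / 3) ([I_angle_ivt]); so it reaches
the direction of the chord or that of its mirror image in b, and changing the
sign of phi exchanges these two.  A positive homothety adjusts the length.

There remains the rational rotation-minimizing frame.  If W is a polynomial with
values in the plane spanned by 1 and b, then Q = A W^* has the same tangent
Q b Q^* / |Q|^2 as A, and the frame that Q rotates does not spin about it as
soon as Im(W^* W') / |W|^2 equals the b-component of A^* A' divided by |A|^2
([rational_RMF_exists]).  For the family above such a W is
  om0 ((1-t)^2 + t^2) + 2 om t (1-t) + om1 (2t-1) b,
with om0 - om1 b = A1^* A0 projected on that plane and om = om0^2 + om1^2; it
satisfies |W|^2 = om |A|^2 ([family_norm], [family_spin]). *)

(** * Vectors and quaternions *)

Section Vector_algebra.
Context {R : realType}.
Implicit Types (u v w : 'rV[R]_3) (P Q X Y Z : quaternion R) (a c : R).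

Lemma row3P u v :
  u 0 (inord 0) = v 0 (inord 0) -> u 0 (inord 1) = v 0 (inord 1) ->
  u 0 (inord 2) = v 0 (inord 2) -> u = v.
Proof.
move=> h0 h1 h2; apply/rowP => k; rewrite -(inord_val k).
by case: k => -[|[|[|]]].
Qed.

Lemma dotvE u v : dotv u v =
  u 0 (inord 0) * v 0 (inord 0) + u 0 (inord 1) * v 0 (inord 1)
  + u 0 (inord 2) * v 0 (inord 2).
Proof.
rewrite /dotv !big_ord_recl big_ord0 addr0 addrA.
by do ![congr (_ + _)]; congr (u 0 _ * v 0 _); apply/val_inj; rewrite /= inordK.
Qed.

Ltac vring := rewrite /= ?dotvE /crossv ?mxE ?inordK //=; ring.
Ltac vecring := apply: row3P; vring.

Lemma dotvC u v : dotv u v = dotv v u.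
Proof. vring. Qed.
Lemma dotvDl u v w : dotv (u + v) w = dotv u w + dotv v w.
Proof. vring. Qed.
Lemma dotvDr u v w : dotv w (u + v) = dotv w u + dotv w v.
Proof. vring. Qed.
Lemma dotvZl a u v : dotv (a *: u) v = a * dotv u v.
Proof. vring. Qed.
Lemma dotvZr a u v : dotv u (a *: v) = a * dotv u v.
Proof. vring. Qed.
Lemma dotvNl u v : dotv (- u) v = - dotv u v.
Proof. vring. Qed.
Lemma dotvNr u v : dotv u (- v) = - dotv u v.
Proof. vring. Qed.

Lemma dotvv_ge0 u : 0 <= dotv u u.
Proof. by rewrite dotvE -!expr2 !addr_ge0 ?sqr_ge0. Qed.

Lemma dotvv_eq0 u : (dotv u u == 0) = (u == 0).
Proof.
apply/eqP/eqP => [|->]; last by vring.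
rewrite dotvE -!expr2 => h; have h0 k := sqr_ge0 (u 0 (inord k)).
have := h0 0; have := h0 1; have := h0 2; move=> k2 k1 k0.
apply: row3P; rewrite mxE; apply/eqP; rewrite -sqrf_eq0; apply/eqP.
all: by lra.
Qed.

Lemma enorm_sqr u : enorm u ^+ 2 = dotv u u.
Proof. by rewrite sqr_sqrtr ?dotvv_ge0. Qed.

Lemma enorm_ge0 u : 0 <= enorm u.
Proof. exact: sqrtr_ge0. Qed.

Lemma enorm_eq0 u : (enorm u == 0) = (u == 0).
Proof. by rewrite -sqrf_eq0 enorm_sqr dotvv_eq0. Qed.

Lemma enorm_eq u a : 0 <= a -> dotv u u = a ^+ 2 -> enorm u = a.
Proof. by move=> a0 h; rewrite /enorm h sqrtr_sqr ger0_norm. Qed.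

Lemma enorm_eq1 u : enorm u = 1 <-> dotv u u = 1.
Proof.
by split=> [h|h]; [rewrite -enorm_sqr h expr1n | rewrite /enorm h sqrtr1].
Qed.

Lemma enormZ a u : 0 <= a -> enorm (a *: u) = a * enorm u.
Proof.
move=> a0; apply: enorm_eq; first by rewrite mulr_ge0 ?enorm_ge0.
by rewrite exprMn enorm_sqr dotvZl dotvZr; ring.
Qed.

Lemma normalizeZ a u : 0 < a -> normalize (a *: u) = normalize u.
Proof.
move=> a0; rewrite /normalize enormZ ?ltW// scalerA invfM mulrAC mulVf ?mul1r//.
by rewrite gt_eqF.
Qed.

Lemma scale_normalize u : enorm u *: normalize u = u.
Proof.
have [->|u0] := eqVneq u 0; first by rewrite /normalize !scaler0.
by rewrite /normalize scalerA mulfV ?scale1r// enorm_eq0.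
Qed.

Lemma dot_normalize u : u != 0 -> dotv (normalize u) (normalize u) = 1.
Proof.
move=> u0; rewrite dotvZl dotvZr -enorm_sqr; have := u0.
rewrite -enorm_eq0 => h; by field.
Qed.

Lemma crossvDl u v w : crossv (u + v) w = crossv u w + crossv v w.
Proof. vecring. Qed.
Lemma crossvDr u v w : crossv w (u + v) = crossv w u + crossv w v.
Proof. vecring. Qed.
Lemma crossvZl a u v : crossv (a *: u) v = a *: crossv u v.
Proof. vecring. Qed.
Lemma crossvZr a u v : crossv u (a *: v) = a *: crossv u v.
Proof. vecring. Qed.
Lemma crossvC u v : crossv u v = - crossv v u.
Proof. vecring. Qed.
Lemma crossvv u : crossv u u = 0.
Proof. vecring. Qed.
Lemma dotv_crossl u v : dotv u (crossv u v) = 0.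
Proof. vring. Qed.
Lemma dotv_crossr u v : dotv v (crossv u v) = 0.
Proof. vring. Qed.
Lemma crossv_crossv u v w :
  crossv u (crossv v w) = dotv u w *: v - dotv u v *: w.
Proof. vecring. Qed.
Lemma dotv_crossv u v :
  dotv (crossv u v) (crossv u v) = dotv u u * dotv v v - dotv u v ^+ 2.
Proof. vring. Qed.

Lemma quatP X Y : X.1 = Y.1 -> X.2 = Y.2 -> X = Y.
Proof. by case: X Y => [? ?] [? ?] /= -> ->. Qed.

Lemma quatZ1 a X : (a *: X).1 = a * X.1 :> R.
Proof. by []. Qed.
Lemma quatZ2 a X : (a *: X).2 = a *: X.2.
Proof. by []. Qed.
Lemma quatD1 X Y : (X + Y).1 = X.1 + Y.1 :> R.
Proof. by []. Qed.
Lemma quatD2 X Y : (X + Y).2 = X.2 + Y.2.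
Proof. by []. Qed.

Ltac qring := apply: quatP;
  rewrite ?(quatZ1, quatZ2, quatD1, quatD2) /qmul /qconj /qpure
  ?(quatZ1, quatZ2, quatD1, quatD2); [vring | vecring].

Lemma qmulA X Y Z : qmul X (qmul Y Z) = qmul (qmul X Y) Z.
Proof. qring. Qed.

Lemma qconjM X Y : qconj (qmul X Y) = qmul (qconj Y) (qconj X).
Proof. qring. Qed.

Lemma qmulDl X Y Z : qmul (X + Y) Z = qmul X Z + qmul Y Z.
Proof. qring. Qed.

Lemma qmulZl a X Y : qmul (a *: X) Y = a *: qmul X Y.
Proof. qring. Qed.

Lemma qmulZr a X Y : qmul X (a *: Y) = a *: qmul X Y.
Proof. qring. Qed.

Lemma qconjZ a X : qconj (a *: X) = a *: qconj X.
Proof. qring. Qed.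

Definition qnorm2 Q : R := (Q.1 : R) ^+ 2 + dotv Q.2 Q.2.

(** The rotation of v induced by Q, scaled by the squared norm of Q. *)
Definition sandwich Q v : 'rV[R]_3 := vect (qmul (qmul Q (qpure v)) (qconj Q)).

Lemma qpure_sandwich Q v :
  qmul (qmul Q (qpure v)) (qconj Q) = qpure (sandwich Q v).
Proof. by congr pair; vring. Qed.

Lemma sandwichM P Q v : sandwich (qmul P Q) v = sandwich P (sandwich Q v).
Proof.
by rewrite {2}/sandwich -qpure_sandwich /sandwich qconjM !qmulA.
Qed.

Lemma sandwichE Q v :
  sandwich Q v = (Q.1 ^+ 2 - dotv Q.2 Q.2) *: v + (2 * dotv Q.2 v) *: Q.2
                 + (2 * Q.1) *: crossv Q.2 v.
Proof. rewrite /sandwich /qmul; vecring. Qed.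

Lemma sandwichZr a Q v : sandwich Q (a *: v) = a *: sandwich Q v.
Proof.
rewrite !sandwichE dotvZr crossvZr !scalerDr !scalerA.
by congr (_ *: _ + _ *: _ + _ *: _); ring.
Qed.

Lemma sandwichK Q v : sandwich Q (sandwich (qconj Q) v) = qnorm2 Q ^+ 2 *: v.
Proof.
rewrite -sandwichM.
have -> : qmul Q (qconj Q) = (qnorm2 Q, 0) by rewrite /qnorm2; qring.
by rewrite sandwichE /=; vecring.
Qed.

Lemma dotv_sandwich Q u v :
  dotv (sandwich Q u) (sandwich Q v) = qnorm2 Q ^+ 2 * dotv u v.
Proof. rewrite !sandwichE /qnorm2; vring. Qed.

Lemma qnorm2_ge0 Q : 0 <= qnorm2 Q.
Proof. by rewrite addr_ge0 ?sqr_ge0 ?dotvv_ge0. Qed.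

End Vector_algebra.

(** * Direct orthonormal frames *)

Section Frames.
Context {R : realType}.
Variables b n m : 'rV[R]_3.
Implicit Types (v : 'rV[R]_3) (t : R).

(** Handedness is part of the definition: the quaternion products of b, n, m
depend on it. *)
Definition direct_frame : Prop :=
  [/\ dotv b b = 1, dotv n n = 1, dotv b n = 0 & crossv b n = m].

Definition comb (x y z : R) : 'rV[R]_3 := x *: b + y *: n + z *: m.

Definition qcomb (w x y z : R) : quaternion R := (w, comb x y z).

Lemma combD x y z x' y' z' :
  comb x y z + comb x' y' z' = comb (x + x') (y + y') (z + z').
Proof. by rewrite /comb !scalerDl addrACA [X in X + _]addrACA. Qed.

Lemma combZ a x y z : a *: comb x y z = comb (a * x) (a * y) (a * z).
Proof. by rewrite /comb !scalerDr !scalerA. Qed.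

Lemma combN x y z : - comb x y z = comb (- x) (- y) (- z).
Proof. by rewrite -scaleN1r combZ !mulN1r. Qed.

Lemma comb100 : comb 1 0 0 = b.
Proof. by rewrite /comb scale1r !scale0r !addr0. Qed.

Hypothesis bnm : direct_frame.

Lemma direct_frame_cross : [/\ crossv b n = m, crossv n m = b & crossv m b = n].
Proof.
case: bnm => bb nn bn <-; split=> //.
  by rewrite crossv_crossv nn (dotvC n) bn scale1r scale0r subr0.
by rewrite crossvC crossv_crossv bb bn scale1r scale0r sub0r opprK.
Qed.

Lemma direct_frame_dot :
  [/\ dotv b b = 1, dotv n n = 1 & dotv m m = 1] /\
  [/\ dotv b n = 0, dotv b m = 0 & dotv n m = 0].
Proof.
case: bnm => bb nn bn <-; split; split=> //.
- by rewrite dotv_crossv bb nn bn expr0n subr0 mulr1.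
- by rewrite dotv_crossl.
- by rewrite dotv_crossr.
Qed.

Lemma dotv_comb x y z x' y' z' :
  dotv (comb x y z) (comb x' y' z') = x * x' + y * y' + z * z'.
Proof.
case: direct_frame_dot => -[bb nn mm] [bn bm nm].
rewrite /comb !(dotvDl, dotvDr, dotvZl, dotvZr).
rewrite !(dotvC n b) !(dotvC m b) !(dotvC m n) bb nn mm bn bm nm; ring.
Qed.

Lemma crossv_comb x y z x' y' z' :
  crossv (comb x y z) (comb x' y' z')
  = comb (y * z' - z * y') (z * x' - x * z') (x * y' - y * x').
Proof.
case: direct_frame_cross => cbn cnm cmb.
rewrite /comb !(crossvDl, crossvDr, crossvZl, crossvZr) !crossvv.
rewrite (crossvC n b) (crossvC m n) (crossvC b m) cbn cnm cmb.
apply: row3P; rewrite !mxE; ring.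
Qed.

Lemma qmul_comb w x y z w' x' y' z' :
  qmul (qcomb w x y z) (qcomb w' x' y' z')
  = qcomb (w * w' - x * x' - y * y' - z * z')
          (w * x' + x * w' + y * z' - z * y')
          (w * y' + y * w' + z * x' - x * z')
          (w * z' + z * w' + x * y' - y * x').
Proof.
apply: quatP; rewrite /qmul /=; first by rewrite dotv_comb; ring.
by rewrite crossv_comb !combZ !combD; congr comb; ring.
Qed.

Lemma qconj_comb w x y z : qconj (qcomb w x y z) = qcomb w (- x) (- y) (- z).
Proof. by rewrite /qconj /= combN. Qed.

Lemma qcombD w x y z w' x' y' z' :
  qcomb w x y z + qcomb w' x' y' z' = qcomb (w + w') (x + x') (y + y') (z + z').
Proof. by apply: quatP; rewrite ?quatD2 //= combD. Qed.

Lemma qcombZ a w x y z :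
  a *: qcomb w x y z = qcomb (a * w) (a * x) (a * y) (a * z).
Proof. by apply: quatP; rewrite ?quatZ2 //= combZ. Qed.

Lemma qnorm2_comb w x y z :
  qnorm2 (qcomb w x y z) = w ^+ 2 + x ^+ 2 + y ^+ 2 + z ^+ 2.
Proof. by rewrite /qnorm2 /= dotv_comb; ring. Qed.

(** The first row of the matrix of a sandwich.  The two other rows come from
cyclic permutations of (x, y, z) and (c1, c2, c3), which is why one function
suffices.  It is stated over any commutative ring to be used both for numbers
and for polynomials. *)
Definition rotc (T : comNzRingType) (w x y z c1 c2 c3 : T) : T :=
  (w ^+ 2 + x ^+ 2 - y ^+ 2 - z ^+ 2) * c1 + 2 * (x * y - w * z) * c2
  + 2 * (x * z + w * y) * c3.

Lemma sandwich_comb w x y z c1 c2 c3 :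
  sandwich (qcomb w x y z) (comb c1 c2 c3)
  = comb (rotc w x y z c1 c2 c3) (rotc w y z x c2 c3 c1)
         (rotc w z x y c3 c1 c2).
Proof.
rewrite sandwichE /= !dotv_comb crossv_comb !combZ !combD /rotc.
by congr comb; ring.
Qed.

(** Orthonormality says that the matrix M of the frame satisfies M M^T = 1;
completeness of the frame is M^T M = 1. *)
Lemma mem_frame v : v = comb (dotv b v) (dotv n v) (dotv m v).
Proof.
have [[bb nn mm] [bn bm nm]] := direct_frame_dot.
pose M : 'M[R]_3 := \matrix_(k < 3) [:: b; n; m]`_k.
have rowM k : row (inord k) M = [:: b; n; m]`_(inord k : 'I_3).
  by rewrite rowK.
have MMT : M *m M^T = 1%:M.
  apply/matrixP => k l.
  have -> : (M *m M^T) k l = dotv (row k M) (row l M).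
    by rewrite !mxE /dotv; apply: eq_bigr => j _; rewrite !mxE.
  rewrite !rowK !mxE.
  case: k => -[|[|[|//]]] ?; case: l => -[|[|[|//]]] ? //=.
  - by rewrite dotvC.
  - by rewrite dotvC.
  - by rewrite dotvC.
have MTM := mulmx1C MMT.
rewrite -[LHS]mulmx1 -MTM mulmxA.
apply/rowP => j; rewrite !mxE /= !big_ord_recl big_ord0 addr0.
have e (k : 'I_3) : (v *m M^T) 0 k = dotv ([:: b; n; m]`_k) v.
  rewrite !mxE /dotv; apply: eq_bigr => l _.
  by rewrite !mxE mulrC.
by rewrite !e !mxE /= addrA.
Qed.

Lemma is_derive_scale_const (h : R -> R) dh v t :
  is_derive t 1 h dh -> is_derive t 1 (fun s => h s *: v) (dh *: v).
Proof.
move=> [dh1 dh2].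
have lim : ((fun s : R => s^-1 *: (((fun s => h s *: v) \o shift t) (s *: 1)
    - h t *: v)) @ (0 : R)^' --> dh *: v)%classic.
  have -> : (fun s : R => s^-1 *: (((fun s => h s *: v) \o shift t) (s *: 1)
    - h t *: v)) = (fun s : R => (s^-1 *: ((h \o shift t) (s *: 1) - h t)) *: v).
    by apply/funext => s /=; rewrite -scalerBl scalerA.
  by apply: cvgZr_tmp; rewrite -dh2.
apply: DeriveDef; first by apply/cvg_ex; exists (dh *: v).
exact/cvg_lim.
Qed.

Lemma is_derive_comb (h1 h2 h3 : R -> R) d1 d2 d3 t :
  is_derive t 1 h1 d1 -> is_derive t 1 h2 d2 -> is_derive t 1 h3 d3 ->
  is_derive t 1 (fun s => comb (h1 s) (h2 s) (h3 s)) (comb d1 d2 d3).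
Proof.
move=> D1 D2 D3; rewrite /comb.
by do 2?apply: is_deriveD; apply: is_derive_scale_const.
Qed.

Lemma is_derive_poly_quotient (N D : {poly R}) t : D.[t] != 0 ->
  is_derive t 1 (fun s => N.[s] / D.[s])
    ((N^`().[t] * D.[t] - N.[t] * D^`().[t]) / D.[t] ^+ 2).
Proof.
move=> D0.
have dV : is_derive t 1 (fun s => D.[s]^-1) (- D.[t] ^- 2 *: D^`().[t]).
  exact: is_deriveV.
have -> : (fun s => N.[s] / D.[s]) = horner N * (fun s => D.[s]^-1) by [].
apply: is_derive_eq.
rewrite /GRing.scale /=; by field.
Qed.

End Frames.

(** * Frames carried by polynomial quaternions *)

Section Rotations.
Context {R : realType}.
Implicit Types (u v : 'rV[R]_3) (Q : quaternion R).

Definition rotate Q v : 'rV[R]_3 := (qnorm2 Q)^-1 *: sandwich Q v.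

Lemma dotv_rotate Q u v : qnorm2 Q != 0 ->
  dotv (rotate Q u) (rotate Q v) = dotv u v.
Proof.
move=> Q0; rewrite dotvZl dotvZr dotv_sandwich; by field.
Qed.

Lemma rotateK Q v : qnorm2 Q != 0 -> rotate Q (rotate (qconj Q) v) = v.
Proof.
move=> Q0; have Qc : qnorm2 (qconj Q) = qnorm2 Q.
  by rewrite /qnorm2 /= dotvNl dotvNr opprK.
rewrite /rotate sandwichZr sandwichK !scalerA Qc -[RHS]scale1r; congr (_ *: _).
by field.
Qed.

(** The half-turn about the bisector of i and b exchanges them; when b = - i
there is no bisector, and the half-turn about n does it. *)
Lemma sandwich_transitive (i b n : 'rV[R]_3) :
  dotv i i = 1 -> dotv b b = 1 -> dotv n n = 1 -> dotv b n = 0 ->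
  exists G : quaternion R, sandwich G i = b.
Proof.
move=> ii bb nn bn.
have sw x v : sandwich (qpure x) v = (2 * dotv x v) *: x - dotv x x *: v.
  rewrite sandwichE /= expr0n /= sub0r mulr0 scale0r addr0 scaleNr addrC.
  by [].
have [ib0|ib0] := eqVneq (i + b) 0.
  have -> : i = - b by apply/eqP; rewrite -addr_eq0 ib0.
  exists (qpure n); rewrite sw dotvNr (dotvC n) bn nn oppr0 mulr0 scale0r.
  by rewrite sub0r scale1r opprK.
exists (qpure (normalize (i + b))); rewrite sw dot_normalize // scale1r.
have e : enorm (i + b) != 0 by rewrite enorm_eq0.
have e2 : enorm (i + b) ^+ 2 = 2 * (1 + dotv i b).
  by rewrite enorm_sqr !(dotvDl, dotvDr) ii bb (dotvC b i); ring.
rewrite /normalize dotvZl scalerA dotvDl ii (dotvC b i).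
have -> : 2 * ((enorm (i + b))^-1 * (1 + dotv i b)) / enorm (i + b) = 1.
  have -> : 2 * ((enorm (i + b))^-1 * (1 + dotv i b)) / enorm (i + b)
    = 2 * (1 + dotv i b) / enorm (i + b) ^+ 2 by field.
  by rewrite -e2 mulfV // expf_neq0.
by rewrite scale1r addrC addKr.
Qed.

End Rotations.

Section Polynomial_quaternions.
Context {R : realType}.
Variables b n m : 'rV[R]_3.
Hypothesis bnm : direct_frame b n m.
Implicit Types (v : 'rV[R]_3) (t : R).

Lemma polynomial_comb (X Y Z : {poly R}) :
  polynomial_curve (fun t => comb b n m X.[t] Y.[t] Z.[t]).
Proof.
exists (fun k => X * (b 0 k)%:P + Y * (n 0 k)%:P + Z * (m 0 k)%:P) => t k.
by rewrite !hornerE !mxE.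
Qed.

Lemma rational_comb (X Y Z D : {poly R}) :
  (forall t, 0 <= t <= 1 -> D.[t] != 0) ->
  rational_on01
    (fun t => comb b n m (X.[t] / D.[t]) (Y.[t] / D.[t]) (Z.[t] / D.[t])).
Proof.
move=> D0 k; exists (X * (b 0 k)%:P + Y * (n 0 k)%:P + Z * (m 0 k)%:P), D.
by split=> // t; rewrite !hornerE !mxE; ring.
Qed.

Variables q0 q1 q2 q3 : {poly R}.

Let Q t := qcomb b n m q0.[t] q1.[t] q2.[t] q3.[t].
Let N : {poly R} := q0 ^+ 2 + q1 ^+ 2 + q2 ^+ 2 + q3 ^+ 2.

Lemma horner_rotc (w x y z : {poly R}) (c1 c2 c3 : R) t :
  (rotc w x y z c1%:P c2%:P c3%:P).[t]
  = rotc w.[t] x.[t] y.[t] z.[t] c1 c2 c3.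
Proof. by rewrite /rotc !hornerE. Qed.

Lemma qnorm2_poly t : qnorm2 (Q t) = N.[t].
Proof. by rewrite qnorm2_comb // !hornerE. Qed.

Lemma rotate_poly c1 c2 c3 t :
  rotate (Q t) (comb b n m c1 c2 c3)
  = comb b n m ((rotc q0 q1 q2 q3 c1%:P c2%:P c3%:P).[t] / N.[t])
               ((rotc q0 q2 q3 q1 c2%:P c3%:P c1%:P).[t] / N.[t])
               ((rotc q0 q3 q1 q2 c3%:P c1%:P c2%:P).[t] / N.[t]).
Proof.
rewrite /rotate qnorm2_poly sandwich_comb // combZ !horner_rotc.
by congr comb; rewrite mulrC.
Qed.

Lemma rational_rotate v : (forall t, 0 <= t <= 1 -> qnorm2 (Q t) != 0) ->
  rational_on01 (fun t => rotate (Q t) v).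
Proof.
move=> N0; rewrite (mem_frame bnm v).
rewrite (funext (fun t => rotate_poly (dotv b v) (dotv n v) (dotv m v) t)).
by apply: rational_comb => t /N0; rewrite qnorm2_poly.
Qed.

(** The b-component of Q^* Q', which measures how fast the frame rotated by Q
turns about its first vector. *)
Definition spin t : R :=
  q0.[t] * q1^`().[t] - q1.[t] * q0^`().[t]
  - (q2.[t] * q3^`().[t] - q3.[t] * q2^`().[t]).

(** With K = (k1, k2, k3) the vector part of Q^* Q', Q' = Q (Q^* Q') / |Q|^2
shows that the derivative of Q v Q^* / |Q|^2 is 2 Q (K x v) Q^* / |Q|^4; this is
its first coordinate, cleared of denominators. *)
Lemma derive_rotc (w x y z : {poly R}) (c1 c2 c3 : R) t :
  let M : {poly R} := w ^+ 2 + x ^+ 2 + y ^+ 2 + z ^+ 2 in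
  let k1 := w.[t] * x^`().[t] - x.[t] * w^`().[t]
            - (y.[t] * z^`().[t] - z.[t] * y^`().[t]) in
  let k2 := w.[t] * y^`().[t] - y.[t] * w^`().[t]
            - (z.[t] * x^`().[t] - x.[t] * z^`().[t]) in
  let k3 := w.[t] * z^`().[t] - z.[t] * w^`().[t]
            - (x.[t] * y^`().[t] - y.[t] * x^`().[t]) in
  let r := rotc w x y z c1%:P c2%:P c3%:P in
  r^`().[t] * M.[t] - r.[t] * M^`().[t]
  = 2 * rotc w.[t] x.[t] y.[t] z.[t]
          (k2 * c3 - k3 * c2) (k3 * c1 - k1 * c3) (k1 * c2 - k2 * c1).
Proof.
rewrite /= /rotc !poly.derivE !hornerE /=.
ring.
Qed.

(** When K and v are both orthogonal to b, K x v is parallel to b, so the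
rotated v moves along the rotated b. *)
Lemma is_derive_rotate v t : qnorm2 (Q t) != 0 -> spin t = 0 ->
  dotv b v = 0 ->
  exists c, is_derive t 1 (fun s => rotate (Q s) v) (c *: rotate (Q t) b).
Proof.
move=> N0 sp0 bv.
rewrite (mem_frame bnm v) bv; set c2 := dotv n v; set c3 := dotv m v.
rewrite (funext (fun s => rotate_poly 0 c2 c3 s)).
pose k2 := q0.[t] * q2^`().[t] - q2.[t] * q0^`().[t]
            - (q3.[t] * q1^`().[t] - q1.[t] * q3^`().[t]).
pose k3 := q0.[t] * q3^`().[t] - q3.[t] * q0^`().[t]
            - (q1.[t] * q2^`().[t] - q2.[t] * q1^`().[t]).
have NP : N = q0 ^+ 2 + q2 ^+ 2 + q3 ^+ 2 + q1 ^+ 2 by rewrite /N; ring.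
have NP' : N = q0 ^+ 2 + q3 ^+ 2 + q1 ^+ 2 + q2 ^+ 2 by rewrite /N; ring.
exists (2 * (k2 * c3 - k3 * c2) / N.[t]).
have Nt : N.[t] != 0 by rewrite -qnorm2_poly.
apply: (is_derive_eq (is_derive_comb b n m (is_derive_poly_quotient _ Nt)
  (is_derive_poly_quotient _ Nt) (is_derive_poly_quotient _ Nt))).
rewrite -[in RHS](comb100 b n m) rotate_poly combZ ![in RHS]horner_rotc.
congr comb.
- have /= := derive_rotc q0 q1 q2 q3 0 c2 c3 t; rewrite -/N => ->.
  rewrite -/(spin t) sp0 -/k2 -/k3 /rotc; by field.
- have /= := derive_rotc q0 q2 q3 q1 c2 c3 0 t; rewrite -NP => ->.
  rewrite -/(spin t) sp0 -/k2 -/k3 /rotc; by field.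
- have /= := derive_rotc q0 q3 q1 q2 c3 0 c2 t; rewrite -NP' => ->.
  rewrite -/(spin t) sp0 -/k2 -/k3 /rotc; by field.
Qed.

End Polynomial_quaternions.

Section Rational_frames.
Context {R : realType}.
Variables b n m : 'rV[R]_3.
Hypothesis bnm : direct_frame b n m.

(** The coordinates on the left are those of P (w0 - w1 b). *)
Lemma spin_mul_conj (p0 p1 p2 p3 w0 w1 : {poly R}) t :
  spin (p0 * w0 + p1 * w1) (p1 * w0 - p0 * w1)
       (p2 * w0 - p3 * w1) (p3 * w0 + p2 * w1) t
  = (w0.[t] ^+ 2 + w1.[t] ^+ 2) * spin p0 p1 p2 p3 t
    - (p0.[t] ^+ 2 + p1.[t] ^+ 2 + p2.[t] ^+ 2 + p3.[t] ^+ 2)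
      * (w0.[t] * w1^`().[t] - w1.[t] * w0^`().[t]).
Proof. rewrite /spin !poly.derivE !hornerE /=; ring. Qed.

(** Right multiplication of P by W^* = w0 - w1 b leaves the tangent alone and
shifts the spin by - Im(W^* W'); the two hypotheses on W make the total spin
vanish.  The vectors v2 and v3 are vi and wi carried back by the rotation at
t = 0. *)
Lemma rational_RMF_exists (p0 p1 p2 p3 w0 w1 : {poly R}) (k c : R)
    (r : R -> 'rV[R]_3) (vi wi : 'rV[R]_3) :
  let P t := qcomb b n m p0.[t] p1.[t] p2.[t] p3.[t] in
  k != 0 -> 0 < c ->
  (forall t, 0 <= t <= 1 -> qnorm2 (P t) != 0) ->
  (forall t, w0.[t] ^+ 2 + w1.[t] ^+ 2 = k * qnorm2 (P t)) ->
  (forall t, w0.[t] * w1^`().[t] - w1.[t] * w0^`().[t]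
             = k * spin p0 p1 p2 p3 t) ->
  (forall t, derive1 r t = c *: sandwich (P t) b) ->
  orthonormal3 (rotate (P 0) b) vi wi ->
  exists f1 f2 f3 : R -> 'rV[R]_3, rational_RMF r f1 f2 f3 /\
    [/\ f1 0 = rotate (P 0) b, f2 0 = vi & f3 0 = wi].
Proof.
move=> P k0 c0 P0 Wnorm Wspin r' ortho.
have bb : dotv b b = 1 by case: bnm.
pose q0 := p0 * w0 + p1 * w1; pose q1 := p1 * w0 - p0 * w1.
pose q2 := p2 * w0 - p3 * w1; pose q3 := p3 * w0 + p2 * w1.
pose Q t := qcomb b n m q0.[t] q1.[t] q2.[t] q3.[t].
have QE t : Q t = qmul (P t) (qcomb b n m w0.[t] (- w1.[t]) 0 0).
  by rewrite qmul_comb // /Q /q0 /q1 /q2 /q3 !hornerE /=; congr qcomb; ring.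
have Qnorm t : qnorm2 (Q t) = k * qnorm2 (P t) ^+ 2.
  rewrite expr2 mulrA -Wnorm /P /Q /q0 /q1 /q2 /q3 !qnorm2_comb // !hornerE /=.
  ring.
have Q0 t : 0 <= t <= 1 -> qnorm2 (Q t) != 0.
  by move=> /P0 h; rewrite Qnorm mulf_neq0 ?expf_neq0.
have Qspin t : spin q0 q1 q2 q3 t = 0.
  rewrite spin_mul_conj Wspin Wnorm /P qnorm2_comb //; ring.
have Qb t : 0 <= t <= 1 -> rotate (Q t) b = rotate (P t) b.
  move=> /P0 h; rewrite /rotate QE sandwichM -QE Qnorm.
  have -> : sandwich (qcomb b n m w0.[t] (- w1.[t]) 0 0) b
            = (k * qnorm2 (P t)) *: b.
    rewrite -[X in sandwich _ X](comb100 b n m) sandwich_comb // -Wnorm.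
    rewrite -[in RHS](comb100 b n m) combZ /rotc; congr comb; ring.
  by rewrite sandwichZr scalerA; congr (_ *: _); field; rewrite k0 h.
have T0 : 0 <= (0 : R) <= 1 by rewrite lexx ler01.
pose v2 := rotate (qconj (Q 0)) vi; pose v3 := rotate (qconj (Q 0)) wi.
have v20 : rotate (Q 0) v2 = vi by rewrite rotateK ?Q0.
have v30 : rotate (Q 0) v3 = wi by rewrite rotateK ?Q0.
case: ortho => -[_ /enorm_eq1 vv /enorm_eq1 ww] [uv uw vw].
have dv : forall x y, dotv x y = dotv (rotate (Q 0) x) (rotate (Q 0) y).
  by move=> x y; rewrite dotv_rotate ?Q0.
have bv2 : dotv b v2 = 0 by rewrite dv v20 Qb.
have bv3 : dotv b v3 = 0 by rewrite dv v30 Qb.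
exists (fun t => rotate (Q t) b), (fun t => rotate (Q t) v2),
  (fun t => rotate (Q t) v3).
split; last by rewrite v20 v30 Qb.
split.
- move=> t t01; split.
    split; [split; apply/enorm_eq1 | split]; rewrite dotv_rotate ?Q0 //.
    + by rewrite dv v20.
    + by rewrite dv v30.
    + by rewrite dv v20 v30.
  rewrite Qb // r' normalizeZ // /rotate /normalize; congr (_^-1 *: _).
  apply/esym/enorm_eq; first exact: qnorm2_ge0.
  by rewrite dotv_sandwich bb mulr1.
- by move=> t t01; split; apply: is_derive_rotate; rewrite ?Q0.
- by split; apply: rational_rotate.
Qed.

End Rational_frames.

(** * A symmetric family of quintics with a rational frame *)

Section Quintic_family.
Context {R : realType}.

(** A, B, D, E are the components of the end control quaternions
A - B b + D n + E m and A + B b - D n + E m, and l + r m is the middle one.  The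
equations on l and r are the algebraic condition on the middle control
quaternion; A E = B D is satisfied by the products of half-angle sines and
cosines, and makes the end tangents orthogonal to n.  The signs of A and l keep
the curve regular. *)
Definition admissible (A B D E l r : R) : Prop :=
  [/\ A ^+ 2 + B ^+ 2 + D ^+ 2 + E ^+ 2 = 1, A * E = B * D,
      l ^+ 2 - r ^+ 2 = A ^+ 2 - B ^+ 2 + D ^+ 2 - E ^+ 2,
      l * r = 2 * (A * E) & 0 < A /\ 0 < l].

(** Changing the sign of phi: the reflection of the family in the plane of
b and m. *)
Lemma admissible_opp A B D E l r :
  admissible A B D E l r -> admissible A (- B) D (- E) l (- r).
Proof.
case=> h1 h2 h3 h4 pos; split; rewrite ?sqrrN //.
  by rewrite mulrN mulNr h2.
by rewrite !mulrN h4.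
Qed.

(** A l > 0 forces E r >= 0, because their product is 2 (A E)^2. *)
Lemma admissible_om0_gt0 A B D E l r :
  admissible A B D E l r -> 0 < A * l + E * r.
Proof.
case=> _ _ _ h4 [A0 l0].
have Al : 0 < A * l by rewrite mulr_gt0.
rewrite ltr_pwDl // -(pmulr_rge0 _ Al).
have -> : (A * l) * (E * r) = 2 * (A * E) ^+ 2.
  have -> : (A * l) * (E * r) = A * E * (l * r) by ring.
  by rewrite h4; ring.
by rewrite mulr_ge0 ?sqr_ge0.
Qed.

Variables b n m : 'rV[R]_3.
Hypothesis bnm : direct_frame b n m.
Variables A B D E l r : R.
Hypothesis adm : admissible A B D E l r.

(** (1-t)^2 + t^2, 2 t (1-t) and 2 t - 1: the Bernstein basis sorted by parity
under t -> 1 - t. *)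
Definition symu : {poly R} := 1 - 2%:P * 'X + 2%:P * 'X ^+ 2.
Definition symv : {poly R} := 2%:P * 'X - 2%:P * 'X ^+ 2.
Definition antis : {poly R} := 2%:P * 'X - 1.

Let p0 := A%:P * symu + l%:P * symv.
Let p1 := B%:P * antis.
Let p2 := - (D%:P * antis).
Let p3 := E%:P * symu + r%:P * symv.
Let P t := qcomb b n m p0.[t] p1.[t] p2.[t] p3.[t].

Let p0E t : p0.[t] = A * (1 - 2 * t + 2 * t ^+ 2) + l * (2 * t - 2 * t ^+ 2).
Proof. by rewrite /p0 /symu /symv !hornerE. Qed.
Let p1E t : p1.[t] = B * (2 * t - 1).
Proof. by rewrite /p1 /antis !hornerE. Qed.
Let p2E t : p2.[t] = - (D * (2 * t - 1)).
Proof. by rewrite /p2 /antis !hornerE. Qed.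
Let p3E t : p3.[t] = E * (1 - 2 * t + 2 * t ^+ 2) + r * (2 * t - 2 * t ^+ 2).
Proof. by rewrite /p3 /symu /symv !hornerE. Qed.
Let PE := (p0E, p1E, p2E, p3E).

Lemma family_control t :
  P t = quadratic_quat (qcomb b n m A (- B) D E) (qcomb b n m l 0 0 r)
                       (qcomb b n m A B (- D) E) t.
Proof.
have B0 : bernstein 2 0 t = (1 - t) ^+ 2 by rewrite /bernstein bin0; ring.
have B1 : bernstein 2 1 t = 2 * t * (1 - t) by rewrite /bernstein bin1; ring.
have B2 : bernstein 2 2 t = t ^+ 2 by rewrite /bernstein binn; ring.
rewrite /quadratic_quat B0 B1 B2 !qcombZ !qcombD /P !PE.
by congr qcomb; ring.
Qed.

(** The scalar component A symu + l symv is positive on [0, 1]. *)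
Lemma family_regular t : 0 <= t <= 1 -> qnorm2 (P t) != 0.
Proof.
move=> /andP[t0 t1]; case: adm => _ _ _ _ [A0 l0].
rewrite qnorm2_comb // gt_eqF // -!addrA ltr_pwDl ?addr_ge0 ?sqr_ge0 //.
rewrite exprn_gt0 // p0E ltr_pwDl ?mulr_ge0 // ?(ltW l0) //; last by nra.
by rewrite mulr_gt0 //; nra.
Qed.

Lemma family_sandwich t :
  let u := 1 - 2 * t + 2 * t ^+ 2 in let v := 2 * t - 2 * t ^+ 2 in
  let s := 2 * t - 1 in
  sandwich (P t) b = comb b n m
    ((A * u + l * v) ^+ 2 + (B * s) ^+ 2 - (D * s) ^+ 2 - (E * u + r * v) ^+ 2)
    (2 * ((A * u + l * v) * (E * u + r * v) - B * D * s ^+ 2))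
    (2 * s * (B * (E * u + r * v) + D * (A * u + l * v))).
Proof.
rewrite -[X in sandwich _ X](comb100 b n m) sandwich_comb // !PE /rotc.
by congr comb; ring.
Qed.

(* om0 - om1 b is the projection of A1^* A0 on the plane of 1 and b. *)
Let om0 := A * l + E * r.
Let om1 := B * l - D * r.
Let om := om0 ^+ 2 + om1 ^+ 2.
Let w0 := om0%:P * symu + om%:P * symv.
Let w1 := om1%:P * antis.

Lemma family_om_gt0 : 0 < om.
Proof.
by rewrite ltr_pwDl ?sqr_ge0 // exprn_gt0 // (admissible_om0_gt0 adm).
Qed.

(* The defining equations in homogeneous form: the proofs below exhibit each
   identity as a combination of these vanishing expressions. *)
Let d1 : A ^+ 2 + B ^+ 2 + D ^+ 2 + E ^+ 2 - 1 = 0.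
Proof. by case: adm => -> *; rewrite subrr. Qed.
Let d2 : A * E - B * D = 0.
Proof. by case: adm => _ -> *; rewrite subrr. Qed.
Let d3 : l ^+ 2 - r ^+ 2 - (A ^+ 2 - B ^+ 2 + D ^+ 2 - E ^+ 2) = 0.
Proof. by case: adm => _ _ -> *; rewrite subrr. Qed.
Let d4 : l * r - 2 * (A * E) = 0.
Proof. by case: adm => _ _ _ -> *; rewrite subrr. Qed.
Let dE := (d1, d2, d3, d4, mulr0, addr0, expr0n).

Lemma family_om_eq :
  2 * om = l ^+ 2 + r ^+ 2 + (A ^+ 2 + E ^+ 2 - B ^+ 2 - D ^+ 2).
Proof.
transitivity (l ^+ 2 + r ^+ 2 + (A ^+ 2 + E ^+ 2 - B ^+ 2 - D ^+ 2)
  + (4 * l * r - 4 * (A * E + B * D)) * (A * E - B * D)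
  + (l ^+ 2 + r ^+ 2 + (A ^+ 2 + E ^+ 2 - B ^+ 2 - D ^+ 2))
    * (A ^+ 2 + B ^+ 2 + D ^+ 2 + E ^+ 2 - 1)
  + (A ^+ 2 + B ^+ 2 - D ^+ 2 - E ^+ 2)
    * (l ^+ 2 - r ^+ 2 - (A ^+ 2 - B ^+ 2 + D ^+ 2 - E ^+ 2))).
  rewrite /om /om0 /om1; ring.
by rewrite !dE.
Qed.

Lemma family_om1_eq : 2 * om1 ^+ 2 = om * (1 - (l ^+ 2 + r ^+ 2)).
Proof.
suff h : 4 * om1 ^+ 2 = 2 * om * (1 - (l ^+ 2 + r ^+ 2)) by lra.
rewrite family_om_eq.
transitivity ((l ^+ 2 + r ^+ 2 + (A ^+ 2 + E ^+ 2 - B ^+ 2 - D ^+ 2))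
    * (1 - (l ^+ 2 + r ^+ 2))
  + (l ^+ 2 + r ^+ 2 + (A ^+ 2 + E ^+ 2 - B ^+ 2 - D ^+ 2))
    * (A ^+ 2 + B ^+ 2 + D ^+ 2 + E ^+ 2 - 1)
  + (12 * (A * E) - 4 * (B * D)) * (A * E - B * D)
  + (2 * (A ^+ 2 - E ^+ 2))
    * (l ^+ 2 - r ^+ 2 - (A ^+ 2 - B ^+ 2 + D ^+ 2 - E ^+ 2))
  + (l ^+ 2 - r ^+ 2 - (A ^+ 2 - B ^+ 2 + D ^+ 2 - E ^+ 2)) ^+ 2
  + (16 * (A * E) - 8 * (B * D)) * (l * r - 2 * (A * E))
  + 4 * (l * r - 2 * (A * E)) ^+ 2).
  rewrite /om1; ring.
by rewrite !dE.
Qed.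

Lemma family_om01_eq : om0 * om1 = om * (A * B - D * E).
Proof.
suff h : 2 * (om0 * om1) = 2 * om * (A * B - D * E) by lra.
rewrite family_om_eq.
transitivity ((l ^+ 2 + r ^+ 2 + (A ^+ 2 + E ^+ 2 - B ^+ 2 - D ^+ 2))
    * (A * B - D * E)
  + (A * B + D * E)
    * (l ^+ 2 - r ^+ 2 - (A ^+ 2 - B ^+ 2 + D ^+ 2 - E ^+ 2))
  + (2 * (B * E - A * D)) * (l * r - 2 * (A * E))
  + (2 * (B * E - A * D)) * (A * E - B * D)).
  rewrite /om0 /om1; ring.
by rewrite !dE.
Qed.

(** Expanding in symu and symv with antis^2 = symu^2 - symv^2, the coefficients
of symu^2 and symu symv agree by definition of om; those of symv^2 because
om1^2 = om (1 - l^2 - r^2) / 2. *)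
Lemma family_norm t : w0.[t] ^+ 2 + w1.[t] ^+ 2 = om * qnorm2 (P t).
Proof.
have e1 := family_om1_eq; have e2 := family_om_eq.
have e3 : om0 ^+ 2 + om1 ^+ 2 - om = 0 by rewrite subrr.
have e4 : om ^+ 2 - om1 ^+ 2 - om * (l ^+ 2 + r ^+ 2 - B ^+ 2 - D ^+ 2) = 0.
  have -> : om1 ^+ 2 = om * (1 - (l ^+ 2 + r ^+ 2)) / 2 by lra.
  have -> : om ^+ 2 = om * ((l ^+ 2 + r ^+ 2
    + (A ^+ 2 + E ^+ 2 - B ^+ 2 - D ^+ 2)) / 2) by rewrite expr2; congr (_ * _); lra.
  transitivity (om / 2 * (A ^+ 2 + B ^+ 2 + D ^+ 2 + E ^+ 2 - 1)); first by field.
  by rewrite !dE.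
rewrite qnorm2_comb // !PE /w0 /w1 /symu /symv /antis !hornerE /=.
move: e3 e4 d1; rewrite /om0; move: om om1 => a c e3 e4 e5.
transitivity (a * ((A * (1 - 2 * t + 2 * t ^+ 2) + l * (2 * t - 2 * t ^+ 2)) ^+ 2
    + (B * (2 * t - 1)) ^+ 2 + (- (D * (2 * t - 1))) ^+ 2
    + (E * (1 - 2 * t + 2 * t ^+ 2) + r * (2 * t - 2 * t ^+ 2)) ^+ 2)
  + (1 - 2 * t + 2 * t ^+ 2) ^+ 2 * ((A * l + E * r) ^+ 2 + c ^+ 2 - a)
  - a * (1 - 2 * t + 2 * t ^+ 2) ^+ 2 * (A ^+ 2 + B ^+ 2 + D ^+ 2 + E ^+ 2 - 1)
  + (2 * t - 2 * t ^+ 2) ^+ 2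
    * (a ^+ 2 - c ^+ 2 - a * (l ^+ 2 + r ^+ 2 - B ^+ 2 - D ^+ 2))).
  ring.
rewrite e3 e4 e5; ring.
Qed.

(** Both sides are linear in symu and symv; comparing the coefficients of symv
reduces the identity to om0 om1 = om (A B - D E). *)
Lemma family_spin t :
  w0.[t] * w1^`().[t] - w1.[t] * w0^`().[t] = om * spin p0 p1 p2 p3 t.
Proof.
have e := family_om01_eq.
have e3 : om0 * om1 - om * (A * B - D * E) = 0 by rewrite e subrr.
rewrite /spin /p0 /p1 /p2 /p3 /w0 /w1 /symu /symv /antis !poly.derivE !hornerE /=.
transitivity (om * (2 * om1 * (1 - 2 * t + 2 * t ^+ 2)
                    + 2 * (A * B - D * E) * (2 * t - 2 * t ^+ 2))
  + 2 * (2 * t - 2 * t ^+ 2) * (om0 * om1 - om * (A * B - D * E))); last first.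
  rewrite e3 mulr0 addr0; congr (_ * _); rewrite /om1; ring.
by move: om om0 om1 => a c d; ring.
Qed.

(* Primitives vanishing at 0 of c0 + c1 v + c2 v^2 and of s (c1 + c2 v), where
   v = 2 t - 2 t^2 and s = 2 t - 1; the second also vanishes at 1. *)
Let prim (c0 c1 c2 : R) : {poly R} :=
  c0%:P * 'X + c1%:P * ('X ^+ 2 - (2 / 3)%:P * 'X ^+ 3)
  + c2%:P * ((4 / 3)%:P * 'X ^+ 3 - 2%:P * 'X ^+ 4 + (4 / 5)%:P * 'X ^+ 5).
Let anti (c1 c2 : R) : {poly R} :=
  c1%:P * ('X ^+ 2 - 'X) - c2%:P * ('X ^+ 2 - 'X) ^+ 2.

Let prim_deriv c0 c1 c2 t :
  (prim c0 c1 c2)^`().[t]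
  = c0 + c1 * (2 * t - 2 * t ^+ 2) + c2 * (2 * t - 2 * t ^+ 2) ^+ 2.
Proof. rewrite /prim !poly.derivE !hornerE /=; by field. Qed.

Let anti_deriv c1 c2 t :
  (anti c1 c2)^`().[t] = (2 * t - 1) * (c1 + c2 * (2 * t - 2 * t ^+ 2)).
Proof. rewrite /anti !poly.derivE !hornerE /=; ring. Qed.

Let X := prim (A ^+ 2 + B ^+ 2 - D ^+ 2 - E ^+ 2)
  (2 * A * (l - A) - 2 * E * (r - E) - 2 * (B ^+ 2 - D ^+ 2))
  ((l - A) ^+ 2 - (r - E) ^+ 2).
Let Y := prim (2 * (A * E - B * D))
  (2 * A * (r - E) + 2 * E * (l - A) + 4 * (B * D)) (2 * (l - A) * (r - E)).
Let Z := anti (2 * (B * E + A * D)) (2 * (B * (r - E) + D * (l - A))).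

Lemma family_hodograph t :
  comb b n m X^`().[t] Y^`().[t] Z^`().[t] = sandwich (P t) b.
Proof.
rewrite family_sandwich /X /Y /Z !prim_deriv anti_deriv.
by congr comb; ring.
Qed.

Lemma family_start : comb b n m X.[0] Y.[0] Z.[0] = 0.
Proof.
rewrite /X /Y /Z /prim /anti !hornerE /= !expr0n /= !(mulr0, subr0, addr0, oppr0).
by rewrite /comb !scale0r !addr0.
Qed.

Lemma family_displacement : comb b n m X.[1] Y.[1] Z.[1] = 5^-1 *: comb b n m
  (3 * (A ^+ 2 - E ^+ 2) + B ^+ 2 - D ^+ 2 + 2 * (A * l - E * r))
  (4 * (A * E) + 2 * (A * r + E * l)) 0.
Proof.
rewrite combZ /X /Y /Z /prim /anti !hornerE /= !expr1n.
case: (adm) => _ h2 h3 h4 _.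
congr comb; last by ring.
- transitivity (5^-1 * (3 * (A ^+ 2 - E ^+ 2) + B ^+ 2 - D ^+ 2 + 2 * (A * l - E * r))
    + 2 / 15 * (l ^+ 2 - r ^+ 2 - (A ^+ 2 - B ^+ 2 + D ^+ 2 - E ^+ 2))).
    by field.
  rewrite !dE; ring.
- transitivity (5^-1 * (4 * (A * E) + 2 * (A * r + E * l))
    + 4 / 15 * (l * r - 2 * (A * E)) + 2 / 3 * (A * E - B * D)).
    by field.
  rewrite !dE; ring.
Qed.

(** The right factor G of the control quaternions turns the axis i into b, and
the factor mu = sqrt (5 ell) gives the curve its size. *)
Lemma family_interpolant (i G p_i p_f vi wi : _) (ell : R) :
  let ui := comb b n m (A ^+ 2 + B ^+ 2 - D ^+ 2 - E ^+ 2) 0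
                       (- (2 * (A * D + B * E))) in
  let uf := comb b n m (A ^+ 2 + B ^+ 2 - D ^+ 2 - E ^+ 2) 0
                       (2 * (A * D + B * E)) in
  sandwich G i = b -> 0 < ell -> orthonormal3 ui vi wi ->
  p_f - p_i = ell *: comb b n m
    (3 * (A ^+ 2 - E ^+ 2) + B ^+ 2 - D ^+ 2 + 2 * (A * l - E * r))
    (4 * (A * E) + 2 * (A * r + E * l)) 0 ->
  exists (c f1 f2 f3 : R -> 'rV[R]_3) (mu : R),
    [/\ RRMF5_I i c, rational_RMF c f1 f2 f3 & 0 < mu] /\
    [/\ c 0 = p_i /\ c 1 = p_f,
        [/\ f1 0 = ui, f2 0 = vi & f3 0 = wi],
        derive1 c 0 = mu ^+ 2 *: ui
      & derive1 c 1 = mu ^+ 2 *: uf].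
Proof.
move=> ui uf Gi ell0 ortho Dp.
pose mu := Num.sqrt (5 * ell).
have mu0 : 0 < mu by rewrite sqrtr_gt0 mulr_gt0.
have mu2 : mu ^+ 2 = 5 * ell by rewrite sqr_sqrtr // mulr_ge0 // ltW.
pose c t := p_i + mu ^+ 2 *: comb b n m X.[t] Y.[t] Z.[t].
have c' t : derive1 c t = mu ^+ 2 *: sandwich (P t) b.
  rewrite -family_hodograph derive1E.
  have dc : is_derive t 1 (fun s => comb b n m X.[s] Y.[s] Z.[s])
      (comb b n m X^`().[t] Y^`().[t] Z^`().[t]).
    by apply: is_derive_comb; exact: is_derive_poly.
  have -> : c = cst p_i + mu ^+ 2 \*: (fun s => comb b n m X.[s] Y.[s] Z.[s]) by [].
  by rewrite derive_val add0r.
have P0 : sandwich (P 0) b = ui.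
  rewrite family_sandwich; case: (adm) => _ h2 _ _ _.
  congr comb; [ring | | ring].
  transitivity (2 * (A * E - B * D)); [ring | by rewrite !dE].
have P1 : sandwich (P 1) b = uf.
  rewrite family_sandwich; case: (adm) => _ h2 _ _ _.
  congr comb; [ring | | ring].
  transitivity (2 * (A * E - B * D)); [ring | by rewrite !dE].
have N0 : qnorm2 (P 0) = 1.
  rewrite qnorm2_comb // !PE.
  transitivity (1 + (A ^+ 2 + B ^+ 2 + D ^+ 2 + E ^+ 2 - 1)); first by ring.
  by rewrite !dE.
have rP0 : rotate (P 0) b = ui by rewrite /rotate N0 P0 invr1 scale1r.
have [|f1 [f2 [f3 [rmf [F1 F2 F3]]]]] := rational_RMF_exists bnm
  (lt0r_neq0 family_om_gt0) (exprn_gt0 2 mu0) family_regular family_norm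
  family_spin c' (vi := vi) (wi := wi).
  by rewrite -/(P 0) rP0.
exists c, f1, f2, f3, mu; split; [split=> // | split].
- split.
    have [S SE] := polynomial_comb b n m X Y Z.
    exists (fun k => (p_i 0 k)%:P + (mu ^+ 2) *: S k) => t k.
    by rewrite hornerD hornerZ hornerC -SE !mxE.
  (* Right multiplication by G reduces the sandwich of i to the one of b. *)
  have CC Q Q' : qmul (qmul (mu *: qmul Q G) (qpure i)) (qconj (mu *: qmul Q' G))
      = mu ^+ 2 *: qmul (qmul Q (qpure b)) (qconj Q').
    rewrite qconjZ !qmulZl qmulZr scalerA -expr2 qconjM.
    by rewrite -Gi -qpure_sandwich !qmulA.
  exists (mu *: qmul (qcomb b n m A (- B) D E) G),
    (mu *: qmul (qcomb b n m l 0 0 r) G), (mu *: qmul (qcomb b n m A B (- D) E) G).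
  split.
    have bE : qpure b = qcomb b n m 0 1 0 0 by rewrite /qpure -[in LHS](comb100 b n m).
    have pE x y z : qpure (comb b n m x y z) = qcomb b n m 0 x y z by [].
    rewrite !CC bE !qconj_comb !qmul_comb // !qcombZ pE.
    case: (adm) => _ h2 h3 h4 _.
    congr qcomb; [ring | | | ring].
      transitivity (mu ^+ 2 * (l ^+ 2 - r ^+ 2)); first by ring.
      rewrite h3; ring.
    transitivity (mu ^+ 2 * (2 * (l * r))); first by ring.
    transitivity (mu ^+ 2 * (2 * (A * E) + 2 * (B * D))); last by ring.
    rewrite h4 -h2; ring.
  move=> t t01 A'.
  have -> : A' = mu *: qmul (P t) G.
    rewrite family_control /A' /quadratic_quat !qmulDl !qmulZl !scalerDr !scalerA.
    by rewrite ![mu * _]mulrC.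
  by rewrite CC qpure_sandwich c'; apply: quatP; rewrite ?quatZ1 ?quatZ2 //= mulr0.
- split; first by rewrite /c family_start scaler0 addr0.
  rewrite /c family_displacement scalerA mu2.
  by rewrite mulrAC mulfV // mul1r -Dp addrC subrK.
- by rewrite F1 F2 F3 -/(P 0) rP0.
- by rewrite c' P0.
- by rewrite c' P1.
Qed.

End Quintic_family.

(** * The vector I_gamma in the frame *)

Section Bisecting.
Context {R : realType}.

Variables b n m : 'rV[R]_3.
Hypothesis bnm : direct_frame b n m.

Lemma enorm_comb x y z :
  enorm (comb b n m x y z) = Num.sqrt (x ^+ 2 + y ^+ 2 + z ^+ 2).
Proof. by rewrite /enorm dotv_comb // !expr2. Qed.

(** In the plane of b and n seen as the complex numbers, q is the square of
w = l + i r and the other vector that of z = A + i E divided by |z|^2.  The sum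
of the two unit vectors z^2 / |z|^2 and w^2 / |w|^2 is a real multiple of z w,
positive because the real part of z times the conjugate of w is. *)
Lemma sqrt_mul_bisector A E l r : 0 < A * l + E * r ->
  let q := comb b n m (l ^+ 2 - r ^+ 2) (2 * (l * r)) 0 in
  (Num.sqrt (enorm q) * Num.sqrt (4 * (A ^+ 2 + E ^+ 2))) *:
    normalize ((4 * (A ^+ 2 + E ^+ 2))^-1 *:
                 comb b n m (4 * (A ^+ 2 - E ^+ 2)) (8 * (A * E)) 0
               + normalize q)
  = comb b n m (2 * (A * l - E * r)) (2 * (A * r + E * l)) 0.
Proof.
move=> pos q.
have M0 : 0 < A ^+ 2 + E ^+ 2.
  rewrite lt0r addr_ge0 ?sqr_ge0 // andbT; apply/eqP => h.
  have /eqP A0 : A == 0 by rewrite -sqrf_eq0; apply/eqP; nra.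
  have /eqP E0 : E == 0 by rewrite -sqrf_eq0; apply/eqP; nra.
  by move: pos; rewrite A0 E0 !mul0r addr0 ltxx.
have L0 : 0 < l ^+ 2 + r ^+ 2.
  rewrite lt0r addr_ge0 ?sqr_ge0 // andbT; apply/eqP => h.
  have /eqP A0 : l == 0 by rewrite -sqrf_eq0; apply/eqP; nra.
  have /eqP E0 : r == 0 by rewrite -sqrf_eq0; apply/eqP; nra.
  by move: pos; rewrite A0 E0 !mulr0 addr0 ltxx.
have qn : enorm q = l ^+ 2 + r ^+ 2.
  by apply: enorm_eq; [exact: ltW | rewrite dotv_comb //; ring].
have -> : (4 * (A ^+ 2 + E ^+ 2))^-1 *:
      comb b n m (4 * (A ^+ 2 - E ^+ 2)) (8 * (A * E)) 0 + normalize q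
    = (2 * (A * l + E * r) / ((A ^+ 2 + E ^+ 2) * (l ^+ 2 + r ^+ 2))) *:
      comb b n m (A * l - E * r) (A * r + E * l) 0.
  rewrite /normalize qn /q !combZ combD.
  by congr comb; field; rewrite !gt_eqF.
rewrite normalizeZ; last by rewrite divr_gt0 ?mulr_gt0.
rewrite /normalize enorm_comb scalerA combZ.
have -> : (A * l - E * r) ^+ 2 + (A * r + E * l) ^+ 2 + 0 ^+ 2
  = (l ^+ 2 + r ^+ 2) * (A ^+ 2 + E ^+ 2) by ring.
rewrite qn !sqrtrM ?(ltW L0) //.
have -> : Num.sqrt (4 : R) = 2.
  by rewrite (_ : 4 = 2 ^+ 2) ?sqrtr_sqr ?ger0_norm // expr2; ring.
have L1 : Num.sqrt (l ^+ 2 + r ^+ 2) != 0 by rewrite gt_eqF // sqrtr_gt0.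
have M1 : Num.sqrt (A ^+ 2 + E ^+ 2) != 0 by rewrite gt_eqF // sqrtr_gt0.
by congr comb; field; rewrite ?L1 ?M1.
Qed.

End Bisecting.

Section Half_turns.
Context {R : realType}.
Implicit Types x g phi : R.

Lemma cos_half x : cos x = 2 * cos (x / 2) ^+ 2 - 1.
Proof.
have -> : cos x = cos ((x / 2) *+ 2) by congr cos; rewrite mulr2n; field.
by rewrite cos_mulr2n; ring.
Qed.

Lemma sin_half x : sin x = 2 * (sin (x / 2) * cos (x / 2)).
Proof.
have -> : sin x = sin ((x / 2) *+ 2) by congr sin; rewrite mulr2n; field.
by rewrite sin_mulr2n; ring.
Qed.

Variable g : R.
Hypothesis g0pi : 0 < g < pi.

(** The parameters of the family for the angles g = gamma and phi: the control
quaternions are those of [admissible], mod_q2 is |q2(phi)| and root_re, root_im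
are the real and imaginary parts of the principal square root of q2(phi) in the
plane of b and n, for 0 <= phi < pi. *)
Definition ctrlA phi := cos (g / 2 / 2) * cos (phi / 2).
Definition ctrlB phi := cos (g / 2 / 2) * sin (phi / 2).
Definition ctrlD phi := sin (g / 2 / 2) * cos (phi / 2).
Definition ctrlE phi := sin (g / 2 / 2) * sin (phi / 2).
Definition mod_q2 phi :=
  Num.sqrt (cos phi ^+ 2 + (sin phi * sin (g / 2)) ^+ 2).
Definition root_re phi := Num.sqrt ((mod_q2 phi + cos phi) / 2).
Definition root_im phi := Num.sqrt ((mod_q2 phi - cos phi) / 2).

Lemma half_angle_pos x : 0 < x < pi -> 0 < cos (x / 2) /\ 0 < sin (x / 2).
Proof.
move=> /andP[x0 xpi]; have := pi_gt0 R => pi0.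
split; [apply: cos_gt0_pihalf | apply: sin_gt0_pihalf]; apply/andP; split; lra.
Qed.

Lemma gamma_half_pos : [/\ 0 < cos (g / 2), 0 < sin (g / 2),
  0 < cos (g / 2 / 2) & 0 < sin (g / 2 / 2)].
Proof.
have [c0 s0] := half_angle_pos g0pi; have pi0 := pi_gt0 R.
have [|c1 s1] := @half_angle_pos (g / 2); last by split.
by case/andP: g0pi => *; apply/andP; split; lra.
Qed.

Lemma mod_q2_sqr phi : mod_q2 phi ^+ 2 = cos phi ^+ 2 + (sin phi * sin (g / 2)) ^+ 2.
Proof. by rewrite sqr_sqrtr // addr_ge0 ?sqr_ge0. Qed.

Lemma cos_le_mod_q2 phi : - mod_q2 phi <= cos phi <= mod_q2 phi.
Proof.
rewrite -ler_norml -sqrtr_sqr; apply: ler_wsqrtr.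
by rewrite lerDl sqr_ge0.
Qed.

Lemma root_re_sqr phi : root_re phi ^+ 2 = (mod_q2 phi + cos phi) / 2.
Proof.
have /andP[h1 h2] := cos_le_mod_q2 phi; rewrite sqr_sqrtr //; lra.
Qed.

Lemma root_im_sqr phi : root_im phi ^+ 2 = (mod_q2 phi - cos phi) / 2.
Proof.
have /andP[h1 h2] := cos_le_mod_q2 phi; rewrite sqr_sqrtr //; lra.
Qed.

Lemma root_re_mul_im phi : 0 <= phi < pi ->
  2 * (root_re phi * root_im phi) = sin phi * sin (g / 2).
Proof.
move=> /andP[p0 ppi]; have [_ s0 _ _] := gamma_half_pos.
have sp : 0 <= sin phi by rewrite sin_ge0_pi // p0 ltW.
have /andP[h1 h2] := cos_le_mod_q2 phi.
rewrite /root_re /root_im -sqrtrM; last by lra.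
have -> : (mod_q2 phi + cos phi) / 2 * ((mod_q2 phi - cos phi) / 2)
  = ((sin phi * sin (g / 2)) / 2) ^+ 2.
  transitivity ((mod_q2 phi ^+ 2 - cos phi ^+ 2) / 4); first by field.
  by rewrite mod_q2_sqr; field.
rewrite sqrtr_sqr ger0_norm; first by field.
by rewrite divr_ge0 // mulr_ge0 // ltW.
Qed.

Lemma half_turn_admissible phi : 0 <= phi < pi ->
  admissible (ctrlA phi) (ctrlB phi) (ctrlD phi) (ctrlE phi)
             (root_re phi) (root_im phi).
Proof.
move=> ppi; have lr := root_re_mul_im ppi; case/andP: ppi => p0 ppi.
have [c0 s0 c1 s1] := gamma_half_pos; have pi0 := pi_gt0 R.
have cs := cos2Dsin2 (g / 2 / 2); have cs' := cos2Dsin2 (phi / 2).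
rewrite /admissible /ctrlA /ctrlB /ctrlD /ctrlE.
set C := cos (g / 2 / 2) in cs c1 *; set S := sin (g / 2 / 2) in cs s1 *.
set a := cos (phi / 2) in cs' *; set e := sin (phi / 2) in cs' *.
split.
- transitivity ((C ^+ 2 + S ^+ 2) * (a ^+ 2 + e ^+ 2)); first by ring.
  by rewrite cs cs' mulr1.
- ring.
- rewrite root_re_sqr root_im_sqr.
  transitivity (cos phi); first by field.
  rewrite cos_half -/a.
  transitivity ((C ^+ 2 + S ^+ 2) * (a ^+ 2 - e ^+ 2)); last by ring.
  by rewrite cs; lra.
- apply: (@mulfI _ 2) => //; rewrite lr (sin_half phi) (sin_half (g / 2)).
  rewrite -/C -/S -/a -/e; ring.
- split.
    rewrite mulr_gt0 // cos_gt0_pihalf //; apply/andP; split; lra.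
  rewrite sqrtr_gt0 divr_gt0 //.
  have [->|pn0] := eqVneq phi 0.
    by rewrite cos0 ltr_wpDl ?sqrtr_ge0.
  have sp : 0 < sin phi by rewrite sin_gt0_pi // lt0r pn0 p0.
  rewrite -[X in _ + X]opprK subr_gt0.
  apply: le_lt_trans (ler_norm _) _; rewrite normrN -sqrtr_sqr ltr_sqrt.
    by rewrite ltrDl exprn_gt0 // mulr_gt0.
  by rewrite ltr_wpDl ?sqr_ge0 // exprn_gt0 // mulr_gt0.
Qed.

End Half_turns.

Section Data_frame.
Context {R : realType}.
Variables ui uf : 'rV[R]_3.
Hypotheses (hui : dotv ui ui = 1) (huf : dotv uf uf = 1).
Hypothesis hcross : crossv ui uf <> 0.

Let g := gamma_angle ui uf.
Let b := bisector ui uf.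
Let n := nvec ui uf.
Let m := (2 * sin (g / 2))^-1 *: (uf - ui).

Lemma gamma_bounds : 0 < g < pi /\ cos g = dotv ui uf.
Proof.
have x2 : 0 < 1 - dotv ui uf ^+ 2.
  rewrite -[X in X - _]mulr1 -{1}hui -huf -dotv_crossv lt0r dotvv_ge0 andbT.
  by rewrite dotvv_eq0; apply/eqP.
have x1 : -1 < dotv ui uf < 1 by apply/andP; split; nra.
have /andP[xl xr] := x1.
split; last by rewrite acosK // in_itv /= !ltW.
by rewrite acos_gt0 ?acos_ltpi //; apply/andP; split; rewrite // ltW.
Qed.

Lemma enorm_sum : enorm (ui + uf) = 2 * cos (g / 2).
Proof.
have [gb cg] := gamma_bounds; have [c0 s0 _ _] := gamma_half_pos gb.
apply: enorm_eq; first by rewrite mulr_ge0 // ltW.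
rewrite !(dotvDl, dotvDr) hui huf (dotvC uf) -cg cos_half; ring.
Qed.

Lemma enorm_cross : enorm (crossv ui uf) = 2 * (cos (g / 2) * sin (g / 2)).
Proof.
have [gb cg] := gamma_bounds; have [c0 s0 _ _] := gamma_half_pos gb.
apply: enorm_eq; first by rewrite !mulr_ge0 // ltW.
have sc := cos2Dsin2 (g / 2).
rewrite dotv_crossv hui huf -cg cos_half.
have -> : (2 * (cos (g / 2) * sin (g / 2))) ^+ 2
  = 4 * cos (g / 2) ^+ 2 * sin (g / 2) ^+ 2 by ring.
by rewrite (_ : sin (g / 2) ^+ 2 = 1 - cos (g / 2) ^+ 2); [ring | lra].
Qed.

Lemma direct_frame_data : direct_frame b n m.
Proof.
have [gb cg] := gamma_bounds; have [c0 s0 _ _] := gamma_half_pos gb.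
have sum0 : ui + uf != 0 by rewrite -enorm_eq0 enorm_sum gt_eqF // mulr_gt0.
split.
- exact: dot_normalize.
- by rewrite /n /nvec dotvNl dotvNr opprK dot_normalize //; apply/eqP.
- rewrite /n /nvec /b /bisector /normalize dotvNr dotvZl dotvZr dotvDl.
  by rewrite dotv_crossl dotv_crossr addr0 !mulr0 oppr0.
rewrite /b /n /m /bisector /nvec /normalize enorm_sum enorm_cross.
rewrite -scaleNr crossvZl crossvZr crossvDl !crossv_crossv hui huf.
rewrite (dotvC uf) -cg (cos_half g).
by apply: row3P; rewrite !mxE; field; rewrite !gt_eqF.
Qed.

Lemma ui_comb : ui = comb b n m (cos (g / 2)) 0 (- sin (g / 2)).
Proof.
have [gb cg] := gamma_bounds; have [c0 s0 _ _] := gamma_half_pos gb.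
rewrite /comb /b /m /bisector /normalize enorm_sum scale0r addr0.
apply: row3P; rewrite !mxE; field; rewrite !gt_eqF //.
Qed.

Lemma uf_comb : uf = comb b n m (cos (g / 2)) 0 (sin (g / 2)).
Proof.
have [gb cg] := gamma_bounds; have [c0 s0 _ _] := gamma_half_pos gb.
rewrite /comb /b /m /bisector /normalize enorm_sum scale0r addr0.
apply: row3P; rewrite !mxE; field; rewrite !gt_eqF //.
Qed.

Let A := ctrlA g.
Let B := ctrlB g.
Let D := ctrlD g.
Let E := ctrlE g.
Let l := root_re g.
Let r := root_im g.

(** The b- and n-coordinates of I_gamma(phi). *)
Definition I_b phi := 3 * (A phi ^+ 2 - E phi ^+ 2) + B phi ^+ 2 - D phi ^+ 2
  + 2 * (A phi * l phi - E phi * r phi).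
Definition I_n phi := 4 * (A phi * E phi) + 2 * (A phi * r phi + E phi * l phi).

Lemma I_gamma_comb phi : 0 <= phi < pi ->
  I_gamma ui uf phi = comb b n m (I_b phi) (I_n phi) 0.
Proof.
move=> ppi; have [gb cg] := gamma_bounds.
have [_ h2 h3 h4 [A0 l0]] := half_turn_admissible gb ppi.
have pos : 0 < A phi * l phi + E phi * r phi.
  by exact: (admissible_om0_gt0 (half_turn_admissible gb ppi)).
have [sA dA sE dI] : [/\ 2 * cos (g / 2) + 2 * cos phi = 4 * (A phi ^+ 2 - E phi ^+ 2),
    2 * (1 + cos phi * cos (g / 2)) = 4 * (A phi ^+ 2 + E phi ^+ 2),
    sin phi * sin (g / 2) = 4 * (A phi * E phi)
  & 3 * (A phi ^+ 2 - E phi ^+ 2) + B phi ^+ 2 - D phi ^+ 2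
    = 2 * cos (g / 2) + cos phi].
  have cs := cos2Dsin2 (g / 2 / 2); have cs' := cos2Dsin2 (phi / 2).
  rewrite (sin_half phi) (sin_half (g / 2)) (cos_half phi) (cos_half (g / 2)).
  rewrite /A /B /D /E /ctrlA /ctrlB /ctrlD /ctrlE !exprMn.
  have -> : sin (g / 2 / 2) ^+ 2 = 1 - cos (g / 2 / 2) ^+ 2 by lra.
  have -> : sin (phi / 2) ^+ 2 = 1 - cos (phi / 2) ^+ 2 by lra.
  by split; ring.
have q1E : q1 ui uf = comb b n m (2 * cos (g / 2)) 0 0.
  rewrite /q1 {1}ui_comb {1}uf_comb combD; congr comb; ring.
have q2E : q2 ui uf phi
    = comb b n m (l phi ^+ 2 - r phi ^+ 2) (2 * (l phi * r phi)) 0.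
  rewrite /l /r root_re_mul_im // root_re_sqr root_im_sqr /q2 /comb scale0r addr0.
  by congr (_ *: _ + _ *: _); field.
rewrite /I_gamma /q3 /s02 /s2 -/g dA.
have -> : q1 ui uf + 2 *: q2 ui uf phi
    = comb b n m (4 * (A phi ^+ 2 - E phi ^+ 2)) (8 * (A phi * E phi)) 0.
  rewrite q1E /q2 -/g sE; apply: row3P; rewrite !mxE -sA; ring.
rewrite q2E (sqrt_mul_bisector direct_frame_data pos) q1E !combD.
have lr2 : l phi ^+ 2 - r phi ^+ 2 = cos phi by rewrite root_re_sqr root_im_sqr; field.
rewrite /I_b /I_n dI lr2 h4 -/(A phi) -/(E phi).
by congr comb; ring.
Qed.

Lemma I_0 : 0 < I_b 0 /\ I_n 0 = 0.
Proof.
have pi0 := pi_gt0 R.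
have z : 0 <= (0 : R) < pi by rewrite lexx.
have n0 : I_n 0 = 0.
  rewrite /I_n /A /E /r /l /ctrlA /ctrlE /root_im mul0r sin0 cos0 !mulr0 mul0r.
  by rewrite /mod_q2 cos0 sin0 mul0r expr1n expr0n /= !addr0 sqrtr1 subrr
    mul0r sqrtr0; ring.
split=> //.
have [gb cg] := gamma_bounds.
have [_ _ _ _ [A0 l0]] := half_turn_admissible gb z.
have [c0 s0 C0 S0] := gamma_half_pos gb.
have cs := cos_half (g / 2); have cs1 := cos2Dsin2 (g / 2 / 2).
have pos : 0 < A 0 * l 0 by rewrite mulr_gt0.
move: pos; rewrite /I_b /A /B /D /E /ctrlA /ctrlB /ctrlD /ctrlE.
rewrite !mul0r sin0 cos0 !mulr1 !mulr0.
by rewrite mul0r !expr0n /=; nra.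
Qed.

(** The n-coordinate is positive for 0 < phi < pi, the b-coordinate for
phi = 0. *)
Lemma I_gamma_neq0 phi : 0 <= phi < pi -> 0 < I_b phi ^+ 2 + I_n phi ^+ 2.
Proof.
move=> /[dup] ppi /andP[p0 plt]; have [gb cg] := gamma_bounds.
have [c0 s0 C0 S0] := gamma_half_pos gb; have pi0 := pi_gt0 R.
have [_ _ _ _ [A0 l0]] := half_turn_admissible gb ppi.
have [pn0|pn0] := eqVneq phi 0.
  rewrite ltr_pwDl ?sqr_ge0 // exprn_gt0 //.
  by rewrite pn0; case: I_0.
have e0 : 0 < sin (phi / 2).
  apply: sin_gt0_pihalf; have pp : 0 < phi by rewrite lt0r pn0 p0.
  by apply/andP; split; lra.
have E0 : 0 < E phi by rewrite mulr_gt0.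
rewrite ltr_wpDl ?sqr_ge0 // exprn_gt0 // /I_n.
apply: ltr_pwDl; first by rewrite pmulr_rgt0 // (mulr_gt0 A0 E0).
by rewrite pmulr_rge0 // addr_ge0 // mulr_ge0 ?sqrtr_ge0 // ltW.
Qed.

Section Continuity.
Implicit Types f h : R -> R.

Lemma contM f h : continuous f -> continuous h -> continuous (fun x => f x * h x).
Proof. by move=> cf ch x; apply: cvgM; [exact: cf | exact: ch]. Qed.
Lemma contD f h : continuous f -> continuous h -> continuous (fun x => f x + h x).
Proof. by move=> cf ch x; apply: cvgD; [exact: cf | exact: ch]. Qed.
Lemma contB f h : continuous f -> continuous h -> continuous (fun x => f x - h x).
Proof. by move=> cf ch x; apply: cvgB; [exact: cf | exact: ch]. Qed.
Lemma contK (c : R) : continuous (fun _ : R => c).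
Proof. by move=> x; exact: cvg_cst. Qed.
Lemma contI : continuous (fun x : R => x).
Proof. by move=> x; exact: cvg_id. Qed.
Lemma contX f : continuous f -> continuous (fun x => f x ^+ 2).
Proof. by move=> cf; exact: contM. Qed.
Lemma contS f : continuous f -> continuous (fun x => Num.sqrt (f x)).
Proof. by move=> cf x; apply: continuous_comp; [exact: cf | exact: sqrt_continuous]. Qed.
Lemma contcos f : continuous f -> continuous (fun x => cos (f x)).
Proof. by move=> cf x; apply: continuous_comp; [exact: cf | exact: continuous_cos]. Qed.
Lemma contsin f : continuous f -> continuous (fun x => sin (f x)).
Proof. by move=> cf x; apply: continuous_comp; [exact: cf | exact: continuous_sin]. Qed.

(* Declared so that the conclusions remain statements of continuity when these
   lemmas are composed, instead of unfolding to neighbourhoods. *)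
Arguments contM {f h} _ _ _ _ _.
Arguments contD {f h} _ _ _ _ _.
Arguments contB {f h} _ _ _ _ _.
Arguments contX {f} _ _ _ _.
Arguments contS {f} _ _ _ _.
Arguments contcos {f} _ _ _ _.
Arguments contsin {f} _ _ _ _.
Arguments contK c _ _ _ : clear implicits.
Arguments contI _ _ _ : clear implicits.

Let halfcont : continuous (fun x : R => x / 2).
Proof. exact: contM contI (contK _). Qed.
Let Acont : continuous A.
Proof. exact: contM (contK _) (contcos halfcont). Qed.
Let Bcont : continuous B.
Proof. exact: contM (contK _) (contsin halfcont). Qed.
Let Dcont : continuous D.
Proof. exact: contM (contK _) (contcos halfcont). Qed.
Let Econt : continuous E.
Proof. exact: contM (contK _) (contsin halfcont). Qed.
Let mod_q2_cont : continuous (mod_q2 g).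
Proof.
exact: contS (contD (contX (contcos contI))
                    (contX (contM (contsin contI) (contK _)))).
Qed.
Let lcont : continuous l.
Proof. exact: contS (contM (contD mod_q2_cont (contcos contI)) (contK _)). Qed.
Let rcont : continuous r.
Proof. exact: contS (contM (contB mod_q2_cont (contcos contI)) (contK _)). Qed.

Lemma I_b_continuous : continuous I_b.
Proof.
exact: contD (contB (contD (contM (contK _) (contB (contX Acont) (contX Econt)))
    (contX Bcont)) (contX Dcont))
  (contM (contK _) (contB (contM Acont lcont) (contM Econt rcont))).
Qed.

Lemma I_n_continuous : continuous I_n.
Proof.
exact: contD (contM (contK _) (contM Acont Econt))
  (contM (contK _) (contD (contM Acont rcont) (contM Econt lcont))).
Qed.

(** The intermediate value theorem for I_b - x |I|, which has no denominator and
is therefore continuous everywhere. *)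
Lemma I_angle_ivt (x phi1 : R) : 0 <= phi1 -> x <= 1 ->
  I_b phi1 <= x * Num.sqrt (I_b phi1 ^+ 2 + I_n phi1 ^+ 2) ->
  exists2 phi, 0 <= phi <= phi1
    & I_b phi = x * Num.sqrt (I_b phi ^+ 2 + I_n phi ^+ 2).
Proof.
move=> p1 x1 le1; have [b0 n0] := I_0.
pose h phi := I_b phi - x * Num.sqrt (I_b phi ^+ 2 + I_n phi ^+ 2).
have hc : continuous h.
  apply: contB; first exact: I_b_continuous.
  apply: contM; first exact: contK.
  by apply: contS; apply: contD; apply: contX;
    [exact: I_b_continuous | exact: I_n_continuous].
have h0 : 0 <= h 0.
  rewrite /h n0 expr0n /= addr0 sqrtr_sqr gtr0_norm //.
  by rewrite -[X in X - _]mul1r -mulrBl mulr_ge0 ?subr_ge0 // ltW.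
have h1 : h phi1 <= 0 by rewrite /h subr_le0.
have [|phi phi01 /eqP] := @IVT R h 0 phi1 0 p1 (continuous_subspaceT hc).
  by rewrite ge_min h1 orbT le_max h0.
rewrite subr_eq0 => /eqP e; by exists phi.
Qed.

End Continuity.

End Data_frame.

(** * Interpolation *)

Theorem proposition4p8 (R : realType)
  (i : 'rV[R]_3) (hi : enorm i = 1)
  (p_i p_f : 'rV[R]_3) (hp : p_i <> p_f)
  (ui vi wi : 'rV[R]_3) (huvw : orthonormal3 ui vi wi)
  (uf : 'rV[R]_3) (huf : enorm uf = 1) (hcross : crossv ui uf <> 0)
  (hsym : dotv ui (normalize (p_f - p_i)) = dotv (normalize (p_f - p_i)) uf)
  (hS : dotv (bisector ui uf) (normalize (p_f - p_i))
        > dotv (bisector ui uf) (S_gamma ui uf (2 * pi / 3))) :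
  exists (r f1 f2 f3 : R -> 'rV[R]_3) (mu : R),
    [/\ RRMF5_I i r, rational_RMF r f1 f2 f3 & 0 < mu] /\
    [/\ r 0 = p_i /\ r 1 = p_f,
        [/\ f1 0 = ui, f2 0 = vi & f3 0 = wi],
        derive1 r 0 = mu ^+ 2 *: ui
      & derive1 r 1 = mu ^+ 2 *: uf].
Proof.
have ii : dotv i i = 1 by apply/enorm_eq1.
have uiui : dotv ui ui = 1 by case: huvw => -[/enorm_eq1].
have ufuf : dotv uf uf = 1 by apply/enorm_eq1.
have pi0 := pi_gt0 R.
have [gb cg] := gamma_bounds uiui ufuf hcross.
have bnm := direct_frame_data uiui ufuf hcross.
have uiE := ui_comb uiui ufuf hcross.
have ufE := uf_comb uiui ufuf hcross.
move: (gamma_half_pos gb) bnm uiE ufE.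
set g := gamma_angle ui uf in gb *; set b := bisector ui uf in hS *.
set n := nvec ui uf; set m := (2 * sin (g / 2))^-1 *: (uf - ui).
move=> [c0 s0 C0 S0] bnm uiE ufE.
have Dp0 : p_f - p_i != 0 by rewrite subr_eq0; apply/eqP => e; exact: hp.
pose du := normalize (p_f - p_i).
pose x := dotv b du; pose y := dotv n du.
have duE : du = comb b n m x y 0.
  rewrite {1}(mem_frame bnm du) -/x -/y; congr comb.
  by rewrite /m dotvZl dotvDl dotvNl -/du hsym (dotvC uf) subrr mulr0.
have xy : x ^+ 2 + y ^+ 2 = 1.
  by have := dot_normalize Dp0; rewrite -/du duE dotv_comb // mulr0 addr0 -!expr2.
have p23 : 0 <= 2 * @pi R / 3 < @pi R by apply/andP; split; lra.
pose nI phi := Num.sqrt (I_b ui uf phi ^+ 2 + I_n ui uf phi ^+ 2).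
have nI0 phi : 0 <= phi < pi -> 0 < nI phi.
  by move=> h; rewrite sqrtr_gt0 (I_gamma_neq0 uiui ufuf hcross).
have hx : I_b ui uf (2 * pi / 3) <= x * nI (2 * pi / 3).
  rewrite -ler_pdivrMr ?nI0 // ltW //.
  move: hS; rewrite -/du -/x; apply: le_lt_trans.
  rewrite /S_gamma (I_gamma_comb uiui ufuf hcross) // /normalize dotvZr.
  rewrite enorm_comb // expr0n addr0 -/(nI _) -[X in dotv X _](comb100 b n m).
  by rewrite dotv_comb // mul1r !mul0r !addr0 mulrC.
have x1 : x <= 1 by nra.
(* I_gamma(phi) makes the same angle with b as the chord does. *)
have [phi /andP[ph0 ph1] Ib] :=
  I_angle_ivt uiui ufuf hcross (proj1 (andP p23)) x1 hx.
have ppi : 0 <= phi < pi by rewrite ph0 (le_lt_trans ph1) //; case/andP: p23.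
have adm := half_turn_admissible gb ppi.
have I0 := nI0 _ ppi.
rewrite -/(nI phi) in Ib.
have In2 : I_n ui uf phi ^+ 2 = (y * nI phi) ^+ 2.
  have : nI phi ^+ 2 = I_b ui uf phi ^+ 2 + I_n ui uf phi ^+ 2.
    by rewrite sqr_sqrtr // addr_ge0 ?sqr_ge0.
  rewrite Ib => e; rewrite exprMn (_ : y ^+ 2 = 1 - x ^+ 2); last by lra.
  by rewrite mulrBl mul1r -exprMn {1}e; ring.
have [G GE] : exists G, sandwich G i = b.
  by case: bnm => bb nn bn _; exact: sandwich_transitive bn.
pose ell := enorm (p_f - p_i) / nI phi.
have ell0 : 0 < ell.
  by rewrite divr_gt0 // lt0r enorm_eq0 Dp0 enorm_ge0.
(* z = 1 or -1 is the side of b on which the chord lies. *)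
have DpE z : I_n ui uf phi * z = y * nI phi ->
    p_f - p_i = ell *: comb b n m (I_b ui uf phi) (I_n ui uf phi * z) 0.
  move=> ->; rewrite Ib -[LHS]scale_normalize -/du duE !combZ.
  by congr comb; rewrite /ell; field; rewrite gt_eqF.
have cE : ctrlA g phi ^+ 2 + ctrlB g phi ^+ 2 - ctrlD g phi ^+ 2 - ctrlE g phi ^+ 2
    = cos (g / 2).
  have cs := cos2Dsin2 (g / 2 / 2); have cs' := cos2Dsin2 (phi / 2).
  rewrite (cos_half (g / 2)).
  transitivity ((cos (g / 2 / 2) ^+ 2 - sin (g / 2 / 2) ^+ 2)
    * (cos (phi / 2) ^+ 2 + sin (phi / 2) ^+ 2)).
    by rewrite /ctrlA /ctrlB /ctrlD /ctrlE; ring.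
  by rewrite cs' mulr1; lra.
have sE : 2 * (ctrlA g phi * ctrlD g phi + ctrlB g phi * ctrlE g phi)
    = sin (g / 2).
  have cs' := cos2Dsin2 (phi / 2).
  rewrite (sin_half (g / 2)).
  transitivity (2 * (sin (g / 2 / 2) * cos (g / 2 / 2))
    * (cos (phi / 2) ^+ 2 + sin (phi / 2) ^+ 2)).
    by rewrite /ctrlA /ctrlB /ctrlD /ctrlE; ring.
  by rewrite cs' mulr1.
(* The chord lies on the side of I_gamma(phi), or on the side of its mirror
   image, which is I_gamma(- phi). *)
have /orP[/eqP yI|/eqP yI] :
    (I_n ui uf phi == y * nI phi) || (I_n ui uf phi == - (y * nI phi)).
  by rewrite -eqf_sqr In2.
- have H := @family_interpolant R b n m bnm _ _ _ _ _ _ adm i G p_i p_f vi wi ell.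
  rewrite /= cE sE -uiE -ufE in H; apply: H => //.
  have := DpE 1; rewrite !mulr1 => /(_ yI) ->.
  by [].
- have H := @family_interpolant R b n m bnm _ _ _ _ _ _ (admissible_opp adm)
    i G p_i p_f vi wi ell.
  rewrite /= !mulrNN !sqrrN cE sE -uiE -ufE in H; apply: H => //.
  rewrite (DpE (-1)); last by rewrite yI mulrN1 opprK.
  by congr (_ *: comb _ _ _ _ _ _); rewrite /I_n; ring.
Qed.
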